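(* For any integers $m\ge3$ and $n\ge2$ with $m\le\frac{n(n+1)}2$, there exist $C\in\mathbb S^n$, a linear map $\mathcal A:\mathbb S^n\to\mathbb R^m$ and $b\in\mathbb R^m$ such that (P) has a unique optimal solution, this solution has rank one, and (P) satisfies strict complementarity; moreover, for $\rho=1$ there is a dual feasible $y$ (i.e. $C-\mathcal A^*y\succeq0$) such that (AL-P) admits a unique solution $X_{y,\rho}$, whose rank $r$ satisfies $r=\max\{l\in\mathbb{N}: \frac{l(l+1)}2\le m\}$.
   Context: $\mathbb S^n$: real symmetric $n\times n$ matrices with the trace inner product. $\mathcal A^*$ is the adjoint of $\mathcal A$; $Z(y)=C-\mathcal A^*y$. (P): minimize $\langle C,X\rangle$ subject to $\mathcal AX=b$, $X\succeq0$. (D): maximize $\langle b,y\rangle$ subject to $Z(y)\succeq0$. (AL-P), for $\rho>0$ and $y\in\mathbb R^m$: minimize $\langle C,X\rangle+\langle y,b-\mathcal AX\rangle+\frac\rho2\|\mathcal AX-b\|_2^2$ over $X\succeq0$. (P) satisfies strict complementarity if there are optimal solutions $X_\star$ of (P) and $y_\star$ of (D) with $\langle C,X_\star\rangle=\langle b,y_\star\rangle$ and $\operatorname{rank}(X_\star)+\operatorname{rank}(Z(y_\star))=n$. *)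

(* Defs.v *)
From HB Require Import structures.
From mathcomp Require Import all_boot all_order all_algebra.
From mathcomp Require Import reals.

Set Implicit Arguments.
Unset Strict Implicit.
Unset Printing Implicit Defensive.

Import Order.TTheory GRing.Theory Num.Theory.
Local Open Scope ring_scope.

Section SymmetricMatrices.
Variables (R : realType) (n : nat).

Record symmat := SymMat {
  symmat_mx :> 'M[R]_n;
  _ : symmat_mx \is symmetricmx }.

HB.instance Definition _ := [isSub for symmat_mx].
HB.instance Definition _ := [Choice of symmat by <:].

Lemma symmetricmxP (X : 'M[R]_n) : reflect (X^T = X) (X \is symmetricmx).
Proof.
by apply: (iffP (is_hermitianmxP _ _ _)) => [|XT];
  rewrite expr0 scale1r map_mx_id // => ->.
Qed.

Fact symmetricmx_submod : submod_closed (symmetricmx : {pred 'M[R]_n}).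
Proof.
split=> [|a X Y]; first by apply/symmetricmxP; rewrite trmx0.
move=> /symmetricmxP eX /symmetricmxP eY; apply/symmetricmxP.
by rewrite linearP /= eX eY.
Qed.

HB.instance Definition _ := GRing.isSubmodClosed.Build R 'M[R]_n
  (symmetricmx : {pred 'M[R]_n}) symmetricmx_submod.
HB.instance Definition _ := [SubChoice_isSubLmodule of symmat by <:].

Lemma symmat_tr (X : symmat) : X^T = X :> 'M[R]_n.
Proof. by case: X => X /= /symmetricmxP. Qed.

Lemma symmatC (X : symmat) i j : (X : 'M_n) i j = (X : 'M_n) j i.
Proof. by rewrite -[in LHS]symmat_tr mxE. Qed.

Fact sympart_subproof (M : 'M[R]_n) : 2^-1 *: (M + M^T) \is symmetricmx.
Proof. by apply/symmetricmxP; rewrite linearZ linearD /= trmxK addrC. Qed.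
Definition sympart (M : 'M[R]_n) : symmat := SymMat (sympart_subproof M).

Lemma symmat_sum_delta (X : symmat) :
  X = \sum_i \sum_j (X : 'M_n) i j *: sympart (delta_mx i j).
Proof.
apply: val_inj; rewrite raddf_sum /=.
have -> : \sum_i val (\sum_j (X : 'M_n) i j *: sympart (delta_mx i j)) =
    2^-1 *: (\sum_i \sum_j (X : 'M_n) i j *: delta_mx i j +
             \sum_i \sum_j (X : 'M_n) i j *: (delta_mx i j)^T).
  rewrite -big_split scaler_sumr; apply: eq_bigr => i _.
  rewrite raddf_sum -big_split scaler_sumr; apply: eq_bigr => j _ /=.
  by rewrite scalerA mulrC -scalerA scalerDr.
rewrite -matrix_sum_delta.
suff -> : \sum_i \sum_j (X : 'M_n) i j *: (delta_mx i j)^T = X :> 'M_n.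
  by rewrite -mulr2n -scaler_nat scalerA mulVf ?scale1r // pnatr_eq0.
rewrite -[RHS]symmat_tr {2}[symmat_mx X]matrix_sum_delta linear_sum.
apply: eq_bigr => i _; rewrite linear_sum; apply: eq_bigr => j _.
by rewrite linearZ.
Qed.

End SymmetricMatrices.

Notation "''S[' R ]_ n" := (symmat R n)
  (at level 0, n at level 2, format "''S[' R ]_ n") : type_scope.

Definition trdot (R : realType) (n : nat) (X Y : 'S[R]_n) : R :=
  \tr (X *m Y).

(* The squared 2-norm of u is dotv u u; the library norm `|u| on matrices is   *)
(* the sup norm.                                                              *)
Definition dotv (R : realType) (m : nat) (u v : 'cV[R]_m) : R :=
  \sum_i u i 0 * v i 0.

Definition psd (R : realType) (n : nat) (X : 'S[R]_n) : Prop :=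
  forall v : 'cV[R]_n, 0 <= (v^T *m X *m v) 0 0.

(* The (i, j) entry of a symmetric matrix M is the inner product of M with    *)
(* the symmetric part of the unit matrix E_ij; this gives the entries of the  *)
(* adjoint. See adjointP and adjoint_unique.                                  *)
Fact adjoint_subproof (R : realType) (n m : nat)
    (A : {linear 'S[R]_n -> 'cV[R]_m}) (y : 'cV[R]_m) :
  \matrix_(i, j) dotv (A (sympart (delta_mx i j))) y \is symmetricmx.
Proof.
apply/symmetricmxP/matrixP => i j; rewrite !mxE; congr (dotv (A _) y).
by apply: val_inj; rewrite /= !trmx_delta addrC.
Qed.

Definition adjoint (R : realType) (n m : nat)
    (A : {linear 'S[R]_n -> 'cV[R]_m}) (y : 'cV[R]_m) : 'S[R]_n :=
  SymMat (adjoint_subproof A y).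

Lemma adjointP (R : realType) (n m : nat)
    (A : {linear 'S[R]_n -> 'cV[R]_m}) (X : 'S[R]_n) (y : 'cV[R]_m) :
  dotv (A X) y = trdot X (adjoint A y).
Proof.
rewrite {1}[X]symmat_sum_delta linear_sum /dotv /trdot /mxtrace.
under eq_bigr => k _ do rewrite summxE mulr_suml.
rewrite exchange_big; apply: eq_bigr => i _ /=.
under eq_bigr => k _ do rewrite linear_sum summxE mulr_suml.
rewrite exchange_big mxE; apply: eq_bigr => j _ /=.
rewrite [(adjoint A y : 'M_n) j i]symmatC mxE /dotv mulr_sumr; apply: eq_bigr => k _.
by rewrite linearZ mxE mulrA.
Qed.

Lemma adjoint_unique (R : realType) (n m : nat)
    (A : {linear 'S[R]_n -> 'cV[R]_m}) (y : 'cV[R]_m) (W : 'S[R]_n) :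
  (forall X : 'S[R]_n, dotv (A X) y = trdot X W) -> W = adjoint A y.
Proof.
move=> WP; apply: val_inj; apply/matrixP => i j; rewrite [RHS]mxE WP /trdot.
rewrite -scalemxAl mulmxDl trmx_delta linearZ linearD /=.
have trE a b : \tr (delta_mx a b *m W) = (W : 'M_n) b a.
  rewrite /mxtrace (bigD1 a) //= big1 => [|k ka]; last first.
    by rewrite mxE big1 // => l _; rewrite mxE (negPf ka) mul0r.
  rewrite addr0 mxE (bigD1 b) //= big1 => [|l lb]; last first.
    by rewrite mxE (negPf lb) andbF mul0r.
  by rewrite mxE !eqxx mul1r addr0.
by rewrite !trE symmatC -mulr2n -[in RHS](mulr_natl (W _ _)) mulKf ?pnatr_eq0.
Qed.

Definition is_minimizer (R : realType) (T : Type) (F : T -> Prop) (f : T -> R)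
    (x : T) : Prop :=
  F x /\ forall x', F x' -> f x <= f x'.

Definition is_maximizer (R : realType) (T : Type) (F : T -> Prop) (f : T -> R)
    (x : T) : Prop :=
  F x /\ forall x', F x' -> f x' <= f x.

Definition primal_opt (R : realType) (n m : nat) (C : 'S[R]_n)
    (A : {linear 'S[R]_n -> 'cV[R]_m}) (b : 'cV[R]_m) (X : 'S[R]_n) : Prop :=
  is_minimizer (fun X' => A X' = b /\ psd X') (trdot C) X.

Definition slack (R : realType) (n m : nat) (C : 'S[R]_n)
    (A : {linear 'S[R]_n -> 'cV[R]_m}) (y : 'cV[R]_m) : 'S[R]_n :=
  C - adjoint A y.

Definition dual_feasible (R : realType) (n m : nat) (C : 'S[R]_n)
    (A : {linear 'S[R]_n -> 'cV[R]_m}) (y : 'cV[R]_m) : Prop :=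
  psd (slack C A y).

Definition dual_opt (R : realType) (n m : nat) (C : 'S[R]_n)
    (A : {linear 'S[R]_n -> 'cV[R]_m}) (b y : 'cV[R]_m) : Prop :=
  is_maximizer (dual_feasible C A) (dotv b) y.

Definition strict_complementarity (R : realType) (n m : nat) (C : 'S[R]_n)
    (A : {linear 'S[R]_n -> 'cV[R]_m}) (b : 'cV[R]_m) : Prop :=
  exists (X : 'S[R]_n) (y : 'cV[R]_m),
    [/\ primal_opt C A b X,
        dual_opt C A b y,
        trdot C X = dotv b y
      & (\rank X + \rank (slack C A y) = n)%N].

Definition aug_lagrangian (R : realType) (n m : nat) (C : 'S[R]_n)
    (A : {linear 'S[R]_n -> 'cV[R]_m}) (b : 'cV[R]_m) (rho : R)
    (y : 'cV[R]_m) (X : 'S[R]_n) : R :=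
  trdot C X + dotv y (b - A X) + rho / 2 * dotv (A X - b) (A X - b).

Definition al_opt (R : realType) (n m : nat) (C : 'S[R]_n)
    (A : {linear 'S[R]_n -> 'cV[R]_m}) (b : 'cV[R]_m) (rho : R)
    (y : 'cV[R]_m) (X : 'S[R]_n) : Prop :=
  is_minimizer (@psd R n) (aug_lagrangian C A b rho y) X.

Definition is_maxn (P : nat -> Prop) (r : nat) : Prop :=
  P r /\ forall l, P l -> (l <= r)%N.

(* Main.v *)
Require Import Defs.
From HB Require Import structures.
From mathcomp Require Import all_boot all_order all_algebra.
From mathcomp Require Import reals.
From mathcomp Require Import zify ring lra.

Import Order.TTheory GRing.Theory Num.Theory.
Local Open Scope ring_scope.

Set Implicit Arguments.
Unset Strict Implicit.
Unset Printing Implicit Defensive.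

(** Only the entries of the leading [r] x [r] block are measured.  The matrix
    [Xopt] = E_00 is determined by its measurements together with the vanishing
    of the remaining diagonal, which [cost] penalizes.  An orthonormal system
    of measurements would make the minimizer of (AL-P) the projection of
    E_00 - Z onto the psd cone, of rank at most one.  Measuring x_ii + x_00
    instead of x_ii (for 0 < i < r) couples the diagonal entries: as soon as
    the penalty x_00 / 2 pulls x_00 down to 1/2, every other x_ii is pushed up
    to 1/2, and the minimizer becomes half the identity of the block, of rank
    [r].  At y = 0, up to the constant 3/8, the augmented Lagrangian is a sum
    of squares and of diagonal entries of X, so its minimizer is unique. *)

(** * Triangular numbers and the enumeration of pairs *)

Lemma triangular_succ j : ((j.+1 * (j.+1 + 1)) %/ 2 = (j * (j + 1)) %/ 2 + j.+1)%N.
Proof. nia. Qed.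

Lemma leq_triangular i j : (i <= j)%N -> ((i * (i + 1)) %/ 2 <= (j * (j + 1)) %/ 2)%N.
Proof. by move=> ij; apply: leq_div2r; apply: leq_mul => //; rewrite leq_add2r. Qed.

Lemma triangular_root m : exists r, is_maxn (fun l : nat => ((l * (l + 1)) %/ 2 <= m)%N) r.
Proof.
have ex0 : exists l, ((l * (l + 1)) %/ 2 <= m)%N by exists 0%N.
have bnd l : ((l * (l + 1)) %/ 2 <= m)%N -> (l <= m)%N.
  by apply: leq_trans; case: l => // l; rewrite triangular_succ leq_addl.
by case: (ex_maxnP ex0 bnd) => r Pr maxr; exists r.
Qed.

(* Column-by-column enumeration of the pairs i <= j: (i, j) has rank j(j+1)/2 + i. *)
Definition pair_code (p : nat * nat) : nat := ((p.2 * (p.2 + 1)) %/ 2 + p.1)%N.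

Lemma pair_code_lt r p : (p.1 <= p.2 < r)%N -> (pair_code p < (r * (r + 1)) %/ 2)%N.
Proof.
case/andP=> p12 p2r; apply: leq_trans (leq_triangular p2r).
by rewrite triangular_succ /pair_code -addnS leq_add2l.
Qed.

(** Distinct columns get disjoint intervals of codes by [pair_code_lt]; within one column the code
    determines the row. *)
Lemma pair_code_inj p q : (p.1 <= p.2)%N -> (q.1 <= q.2)%N ->
  pair_code p = pair_code q -> p = q.
Proof.
case: p q => [a b] [c d] /= ab cd e.
have [bd|db|bd] := ltngtP b d.
- have := @pair_code_lt d (a, b); rewrite /= ab bd => /(_ isT).
  by rewrite e /pair_code /= ltnNge leq_addr.
- have := @pair_code_lt b (c, d); rewrite /= cd db => /(_ isT).
  by rewrite -e /pair_code /= ltnNge leq_addr.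
- by move: e; rewrite bd /pair_code /= => /addnI ->.
Qed.

(** * Vectors indexed through a code *)

Section Scatter.
Variables (R : realType) (m : nat) (T : finType) (P : pred T) (f : T -> nat).

(** Summing over preimages avoids an inverse of [f]; coordinates that are no code are 0. *)
Definition scatter (h : T -> R) : 'cV[R]_m :=
  \col_k \sum_(p | P p && (f p == k)) h p.

Lemma scatter_linear a h h' :
  scatter (fun p => a * h p + h' p) = a *: scatter h + scatter h'.
Proof. by apply/colP => k; rewrite !mxE big_split mulr_sumr. Qed.

Lemma dotv_scatter h h' :
    (forall p, P p -> (f p < m)%N) ->
    (forall p q, P p -> P q -> f p = f q -> p = q) ->
  dotv (scatter h) (scatter h') = \sum_(p | P p) h p * h' p.
Proof.
move=> fm finj; rewrite /dotv.
under eq_bigr => k _ do rewrite mxE mulr_suml.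
rewrite (exchange_big_dep P) => [|k p _ /andP[] //]; apply: eq_bigr => p Pp.
rewrite (big_pred1 (Ordinal (fm p Pp))) => [|k]; last first.
  by rewrite /= Pp -val_eqE eq_sym.
rewrite mxE (big_pred1 p) // => q /=; apply/andP/eqP => [[Pq /eqP]|->//].
by move/finj => ->.
Qed.

End Scatter.

Lemma dotv0l (R : realType) (m : nat) (u : 'cV[R]_m) : dotv 0 u = 0.
Proof. by rewrite /dotv big1 // => i _; rewrite mxE mul0r. Qed.

Lemma slack0 (R : realType) (n m : nat) (C : 'S[R]_n)
  (A : {linear 'S[R]_n -> 'cV[R]_m}) : slack C A 0 = C.
Proof.
rewrite /slack -[RHS]subr0; congr (_ - _); symmetry; apply: adjoint_unique => X.
by rewrite /trdot mulmx0 linear0 /dotv big1 // => i _; rewrite mxE mulr0.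
Qed.

(** * Positive semidefinite and diagonal matrices *)

Section Psd.
Variables (R : realType) (n : nat).
Implicit Types X : 'S[R]_n.

Lemma delta_form (X : 'M[R]_n) i j :
  ((delta_mx i 0 : 'cV_n)^T *m X *m (delta_mx j 0 : 'cV_n)) 0 0 = X i j.
Proof. by rewrite trmx_delta -rowE -colE !mxE. Qed.

Lemma psd_diag_ge0 X i : psd X -> 0 <= (X : 'M_n) i i.
Proof. by move=> /(_ (delta_mx i 0)); rewrite delta_form. Qed.

(** At t e_i + e_j the quadratic form is 2ta + c, affine in t; a nonzero slope would make it
    negative somewhere. *)
Lemma psd_diag_eq0 X i j : psd X -> (X : 'M_n) i i = 0 -> (X : 'M_n) i j = 0.
Proof.
move=> Xpsd Xii; apply/eqP; apply: contraT => Xij.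
set a := (X : 'M_n) i j in Xij *; set c := (X : 'M_n) j j.
(* Solves 2ta + c = -1. *)
pose t := - (c + 1) / (2 * a).
pose u : 'cV[R]_n := delta_mx i 0; pose v : 'cV[R]_n := delta_mx j 0.
have := Xpsd (t *: u + v).
have -> : (t *: u + v)^T = t *: u^T + v^T by rewrite linearP.
rewrite !(mulmxDl, mulmxDr) -!(scalemxAl, scalemxAr).
rewrite ![((_ + _ : 'M_(_, _)) _ _)]mxE ![((_ *: _ : 'M_(_, _)) _ _)]mxE.
rewrite !delta_form Xii (symmatC X j i) -/a -/c.
have -> : t * (t * 0) + t * a + (t * a + c) = -1.
  by rewrite /t; field.
by rewrite ler0N1.
Qed.

Fact diag_sym_subproof (d : 'I_n -> R) : diag_mx (\row_i d i) \is symmetricmx.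
Proof. by apply/symmetricmxP; rewrite tr_diag_mx. Qed.
Definition diag_sym (d : 'I_n -> R) : 'S[R]_n := SymMat (diag_sym_subproof d).

Lemma diag_symE d i j : (diag_sym d : 'M_n) i j = if i == j then d i else 0.
Proof. by rewrite !mxE; case: eqP => [->|]; rewrite ?mulr1n ?mulr0n. Qed.

Lemma eq_diag_sym d d' : d =1 d' -> diag_sym d = diag_sym d'.
Proof.
by move=> e; apply: val_inj; apply/matrixP => i j; rewrite !diag_symE e.
Qed.

Lemma diag_symB d d' : diag_sym d - diag_sym d' = diag_sym (fun i => d i - d' i).
Proof.
apply: val_inj; apply/matrixP => i j; rewrite /= [LHS]mxE [X in _ + X]mxE.
by rewrite !diag_symE; case: eqP; rewrite ?subrr.
Qed.

Lemma trdotC X Y : trdot X Y = trdot Y X.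
Proof. by rewrite /trdot mxtrace_mulC. Qed.

Lemma trdot_diag d X : trdot (diag_sym d) X = \sum_i d i * (X : 'M_n) i i.
Proof.
rewrite /trdot /mxtrace; apply: eq_bigr => i _.
by rewrite mul_diag_mx !mxE.
Qed.

Lemma psd_diag_sym d : (forall i, 0 <= d i) -> psd (diag_sym d).
Proof.
move=> d0 v; rewrite -mulmxA mul_diag_mx mxE sumr_ge0 // => i _.
by rewrite !mxE mulrCA mulr_ge0 // -expr2 sqr_ge0.
Qed.

(** A zero diagonal entry kills its row and column, so only the entries between nonzero diagonal
    positions need checking. Both uniqueness proofs end here. *)
Lemma psd_eq_diag_sym d X :
    psd X -> (forall i, (X : 'M_n) i i = d i) ->
    (forall i j : 'I_n, (i < j)%N -> d i != 0 -> d j != 0 -> (X : 'M_n) i j = 0) ->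
  diag_sym d = X.
Proof.
move=> Xpsd Xd off.
have X0 (i j : 'I_n) : (i < j)%N -> (X : 'M_n) i j = 0.
  move=> ij; have [di|di] := eqVneq (d i) 0.
    by apply: psd_diag_eq0; rewrite ?Xd.
  have [dj|dj] := eqVneq (d j) 0; last exact: off.
  by rewrite symmatC; apply: psd_diag_eq0; rewrite ?Xd.
apply: val_inj; apply/matrixP => i j; rewrite /= diag_symE.
case: (ltngtP i j) => [ij|ji|/val_inj ->]; last by rewrite eqxx Xd.
- by rewrite X0 // -val_eqE ltn_eqF.
- by rewrite symmatC X0 // -val_eqE eq_sym ltn_eqF.
Qed.

End Psd.

(** * The instance and its dual certificate *)

Section Instance.
Variables (R : realType) (m n r : nat).
Implicit Types (X : 'S[R]_n.+1) (p : 'I_n.+1 * 'I_n.+1).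

Definition block p : bool := (p.1 <= p.2 < r)%N.

Definition code p : nat := pair_code (val p.1, val p.2).

Definition entry X p : R := (X : 'M_n.+1) p.1 p.2 +
  if (p.1 == p.2) && (p.1 != 0) then (X : 'M_n.+1) 0 0 else 0.

Definition measure X : 'cV[R]_m := scatter m block code (entry X).

Fact measure_linear : linear measure.
Proof.
move=> a X Y; rewrite -scatter_linear /measure; apply/colP => k.
rewrite !mxE; apply: eq_bigr => p _; rewrite /entry /= !mxE.
by case: ifP => _; ring.
Qed.
HB.instance Definition _ :=
  GRing.isLinear.Build R 'S[R]_n.+1 'cV[R]_m *:%R measure measure_linear.

Definition cost : 'S[R]_n.+1 :=
  diag_sym (fun i => if i == 0 then 2^-1 else (r <= i)%:R).
Definition Xopt : 'S[R]_n.+1 := diag_sym (fun i => (i == 0)%:R).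
Definition Xal : 'S[R]_n.+1 := diag_sym (fun i => if (i < r)%N then 2^-1 else 0).
(* The multiplier of the (0, 0) measurement also has to offset the contribution
   of x_00 to the r - 1 measurements x_ii + x_00. *)
Definition yweight p : R :=
  if p.1 == p.2 then
    if p.1 == 0 then 2^-1 + \sum_(i : 'I_n.+1 | (i != 0) && (i < r)%N) 1 else -1
  else 0.
Definition yopt : 'cV[R]_m := scatter m block code yweight.

Hypotheses (r_gt0 : (0 < r)%N) (r_le : (r <= n.+1)%N).
Hypothesis r_tri : ((r * (r + 1)) %/ 2 <= m)%N.

(** The codes of the block are distinct and, by [r_tri], below m, so no two measurements share a
    coordinate. *)
Lemma dotv_measure X h :
  dotv (measure X) (scatter m block code h) = \sum_(p | block p) entry X p * h p.
Proof.
apply: dotv_scatter => [p bp|[a b] [c d] /andP[/= ab _] /andP[/= cd _]].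
  by apply: leq_trans r_tri; apply: pair_code_lt.
by move=> /(pair_code_inj (p := (val a, val b)) (q := (val c, val d)) ab cd)
  [/val_inj -> /val_inj ->].
Qed.

Lemma sum_block_diag (F : 'I_n.+1 * 'I_n.+1 -> R) :
    (forall i j, i != j -> F (i, j) = 0) ->
  \sum_(p | block p) F p = \sum_(i : 'I_n.+1 | (i < r)%N) F (i, i).
Proof.
move=> F0; rewrite [LHS]big_mkcond [RHS]big_mkcond /=.
transitivity (\sum_i \sum_j if block (i, j) then F (i, j) else 0).
  by rewrite pair_bigA; apply: eq_bigr => -[].
apply: eq_bigr => i _; rewrite (bigD1 i) //= big1 => [|j ji]; last first.
  by rewrite F0 ?if_same // eq_sym.
by rewrite addr0 /block /= leqnn.
Qed.

(** The adjoint of [yopt] cancels the cost 1/2 at (0, 0) and is -1 on the rest of the block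
    diagonal, where the cost is 0; beyond the block the cost alone gives 1. *)
Lemma slack_yopt : slack cost measure yopt = diag_sym (fun i => (i != 0)%:R).
Proof.
have -> : slack cost measure yopt =
    cost - diag_sym (fun i => if i == 0 then 2^-1 else - (i < r)%N%:R).
  congr (_ - _); symmetry; apply: adjoint_unique => X.
  rewrite dotv_measure sum_block_diag => [|i j ij]; last first.
    by rewrite /yweight /= (negPf ij) mulr0.
  rewrite trdotC trdot_diag /= (bigD1 0) //= [RHS](bigD1 0) //=.
  rewrite /entry /yweight /= ?eqxx /= ?addr0 mulrDr -addrA [_^-1 * _]mulrC.
  (* Each x_00 in a measurement x_ii + x_00 has weight -1 and cancels one summand of the (0, 0)
     multiplier. *)
  congr (_ + _); rewrite mulr_sumr (eq_bigl _ _ (fun i => andbC _ _)) -big_split /=.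
  rewrite big_mkcond [RHS]big_mkcond /=; apply: eq_bigr => i _.
  rewrite eqxx /=; case: (eqVneq i 0) => /=; rewrite ?andbF ?andbT // => _.
  by case: (i < r)%N => /=; ring.
rewrite diag_symB; apply: eq_diag_sym => i.
case: eqP => _; rewrite ?subrr // leqNgt.
by case: (i < r)%N => /=; ring.
Qed.

(** * Squared residual and trace outside the block *)

Definition misfit X : R := \sum_(p | block p) (entry X p - entry Xopt p) ^+ 2.

Lemma dotv_misfit X :
  dotv (measure X - measure Xopt) (measure X - measure Xopt) = misfit X.
Proof.
have -> : measure X - measure Xopt = measure (X - Xopt) by rewrite linearB.
rewrite {2}/measure dotv_measure; apply: eq_bigr => p _.
have -> : entry (X - Xopt) p = entry X p - entry Xopt p.
  by rewrite /entry /= !mxE; case: ifP => _; ring.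
by rewrite expr2.
Qed.

Lemma misfit_ge0 X : 0 <= misfit X.
Proof. by apply: sumr_ge0 => p _; apply: sqr_ge0. Qed.


Lemma entry_diag (d : 'I_n.+1 -> R) i j :
  entry (diag_sym d) (i, j) = if i == j then d i + (i != 0)%:R * d 0 else 0.
Proof.
rewrite /entry /= !diag_symE eqxx; case: eqP => //= _; last by rewrite addr0.
by case: eqP => _ /=; rewrite ?mul0r ?mul1r.
Qed.

Lemma misfit_eq0 X p : misfit X = 0 -> block p -> entry X p = entry Xopt p.
Proof.
move=> X0 bp; apply/eqP; rewrite -subr_eq0 -sqrf_eq0; apply/eqP.
by apply: (psumr_eq0P _ X0) => // q _; apply: sqr_ge0.
Qed.

Lemma measure_misfit X : measure X = measure Xopt -> misfit X = 0.
Proof. by move=> e; rewrite -dotv_misfit e subrr dotv0l. Qed.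

Definition tail_trace X : R := \sum_(i : 'I_n.+1 | (r <= i)%N) (X : 'M_n.+1) i i.

Lemma trdot_cost X : trdot cost X = (X : 'M_n.+1) 0 0 / 2 + tail_trace X.
Proof.
rewrite trdot_diag (bigD1 0) //= mulrC /tail_trace [in RHS]big_mkcond.
congr (_ + _); rewrite [RHS](bigD1 0) //= leqNgt r_gt0 add0r.
apply: eq_bigr => i /negPf ->.
by case: ifP; rewrite ?mul1r ?mul0r.
Qed.

Lemma tail_trace_ge0 X : psd X -> 0 <= tail_trace X.
Proof. by move=> Xpsd; apply: sumr_ge0 => i _; apply: psd_diag_ge0. Qed.

Lemma tail_trace_eq0 X (i : 'I_n.+1) :
  psd X -> tail_trace X = 0 -> (r <= i)%N -> (X : 'M_n.+1) i i = 0.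
Proof. by move=> Xpsd /psumr_eq0P; apply=> // j _; apply: psd_diag_ge0. Qed.

Lemma tail_trace_diag (d : 'I_n.+1 -> R) :
  (forall i : 'I_n.+1, (r <= i)%N -> d i = 0) -> tail_trace (diag_sym d) = 0.
Proof. by move=> d0; apply: big1 => i ri; rewrite diag_symE eqxx d0. Qed.

Lemma Xopt00 : (Xopt : 'M_n.+1) 0 0 = 1.
Proof. by rewrite diag_symE. Qed.

Lemma psd_Xopt : psd Xopt.
Proof. by apply: psd_diag_sym => i; rewrite ler0n. Qed.

Lemma tail_trace_Xopt : tail_trace Xopt = 0.
Proof.
apply: tail_trace_diag => i; case: eqP => // ->.
by rewrite leqNgt r_gt0.
Qed.

Lemma block00 : block (0, 0).
Proof. by rewrite /block /= r_gt0. Qed.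

Lemma feasible00 X : measure X = measure Xopt -> (X : 'M_n.+1) 0 0 = 1.
Proof.
move=> /measure_misfit /misfit_eq0 /(_ block00).
by rewrite /entry /= Xopt00 !addr0.
Qed.

(** * The primal problem and strict complementarity *)

Lemma primal_opt_Xopt : primal_opt cost measure (measure Xopt) Xopt.
Proof.
split=> [|X [AX Xpsd]]; first by split; [|exact: psd_Xopt].
rewrite !trdot_cost tail_trace_Xopt (feasible00 AX) Xopt00 lerD2l.
exact: tail_trace_ge0.
Qed.

(** Feasibility fixes x_00 = 1, hence x_ii = 0 for 0 < i < r; optimality makes the remaining
    diagonal vanish. *)
Lemma primal_opt_unique X : primal_opt cost measure (measure Xopt) X -> Xopt = X.
Proof.
move=> [[AX Xpsd] /(_ Xopt (conj erefl psd_Xopt))].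
rewrite !trdot_cost tail_trace_Xopt (feasible00 AX) Xopt00 lerD2l => tail_le0.
have tail0 : tail_trace X = 0.
  by apply/eqP; rewrite eq_le tail_le0 tail_trace_ge0.
apply: (psd_eq_diag_sym Xpsd) => [i|i j ij]; last first.
  have /negPf -> : j != 0 by rewrite -val_eqE -lt0n (leq_ltn_trans _ ij).
  by rewrite eqxx.
have [ri|ir] := leqP r i.
  rewrite (tail_trace_eq0 Xpsd tail0 ri).
  by case: eqP ri => // ->; rewrite leqNgt r_gt0.
have [->|i0] := eqVneq i 0; first exact: feasible00.
have := misfit_eq0 (measure_misfit AX) (p := (i, i)).
rewrite /block /= leqnn ir => /(_ isT).
rewrite entry_diag /entry /= !eqxx i0 (negPf i0) (feasible00 AX) /= mul1r.
by move=> /addIr.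
Qed.

Lemma Xopt_pid : Xopt = pid_mx 1 :> 'M_n.+1.
Proof.
apply/matrixP => i j; rewrite diag_symE mxE ltnS leqn0 -[i == j]val_eqE.
by case: (_ == _).
Qed.

Lemma strict_complementarity_Xopt :
  strict_complementarity cost measure (measure Xopt).
Proof.
(* The duality gap is the inner product of the slack with [Xopt] = E_00: nonnegative for dual
   feasible [y], zero at [yopt]. *)
have gap y : trdot cost Xopt - dotv (measure Xopt) y =
    (slack cost measure y : 'M_n.+1) 0 0.
  rewrite adjointP -[trdot Xopt _]trdotC !/(trdot _ Xopt) -linearB /= -mulmxBl.
  rewrite -/(slack cost measure y) -[LHS]/(trdot (slack cost measure y) Xopt).
  rewrite trdotC trdot_diag (bigD1 0) //= mul1r big1 ?addr0 // => i /negPf ->.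
  by rewrite mul0r.
have gap0 : trdot cost Xopt = dotv (measure Xopt) yopt.
  by apply/eqP; rewrite -subr_eq0 gap slack_yopt diag_symE.
exists Xopt, yopt; split=> //; first exact: primal_opt_Xopt.
  split=> [|y yfeas].
    by rewrite /dual_feasible slack_yopt; apply: psd_diag_sym => i; rewrite ler0n.
  by rewrite -gap0 -subr_ge0 gap psd_diag_ge0.
rewrite slack_yopt.
(* The slack is the identity minus [Xopt], so the two ranks add up to the full size. *)
have -> : (diag_sym (fun i : 'I_n.+1 => (i != 0)%:R : R) : 'M_n.+1) = copid_mx 1.
  rewrite /copid_mx -Xopt_pid; apply/matrixP => i j.
  rewrite [RHS]mxE [X in _ + X]mxE !diag_symE mxE.
  by case: eqP => _; [case: eqP => _; rewrite ?subrr ?subr0 | rewrite subr0].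
by rewrite Xopt_pid rank_pid_mx // rank_copid_mx // subnKC.
Qed.

Lemma rank_Xopt : \rank Xopt = 1%N.
Proof. by rewrite Xopt_pid rank_pid_mx. Qed.

(** * The augmented Lagrangian at y = 0 *)

Lemma aug_lagrangian0 X :
  aug_lagrangian cost measure (measure Xopt) 1 0 X =
  trdot cost X + misfit X / 2.
Proof. by rewrite /aug_lagrangian dotv0l addr0 dotv_misfit mul1r mulrC. Qed.

Definition offcorner_misfit X : R :=
  \sum_(p | block p && (p != (0, 0))) (entry X p - entry Xopt p) ^+ 2.

(** Completing the square at the corner: x/2 + (x - 1)^2/2 = 3/8 + (x - 1/2)^2/2. All terms but 3/8
    are nonnegative on the psd cone. *)
Lemma aug_lagrangian_squares X :
  aug_lagrangian cost measure (measure Xopt) 1 0 X =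
  3 / 8 + (tail_trace X + ((X : 'M_n.+1) 0 0 - 2^-1) ^+ 2 / 2 + offcorner_misfit X / 2).
Proof.
rewrite aug_lagrangian0 trdot_cost /misfit (bigD1 (0, 0)) ?block00 //=.
rewrite -/(offcorner_misfit X) /entry /= Xopt00 !addr0.
by field.
Qed.

Lemma psd_Xal : psd Xal.
Proof. by apply: psd_diag_sym => i; case: ifP => // _; rewrite invr_ge0 ler0n. Qed.

Lemma aug_lagrangian_Xal :
  aug_lagrangian cost measure (measure Xopt) 1 0 Xal = 3 / 8.
Proof.
rewrite aug_lagrangian_squares tail_trace_diag => [|i]; last first.
  by rewrite ltnNge => ->.
rewrite diag_symE /= r_gt0 subrr /offcorner_misfit big1 => [|[i j]]; first by field.
rewrite /block /= => /andP[/andP[ij jr] ij0]; rewrite !entry_diag.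
case: (i =P j) ij0 => [->|_ _]; last by rewrite subrr expr0n.
(* Both measurements equal 1: 1/2 + 1/2 for [Xal], 0 + 1 for [Xopt]. *)
rewrite xpair_eqE andbb => j0; rewrite jr r_gt0 j0 (negPf j0) /=.
by field.
Qed.

Lemma al_opt_Xal : al_opt cost measure (measure Xopt) 1 0 Xal.
Proof.
split=> [|X Xpsd]; first exact: psd_Xal.
rewrite aug_lagrangian_Xal aug_lagrangian_squares lerDl.
rewrite !addr_ge0 ?tail_trace_ge0 ?divr_ge0 ?sqr_ge0 ?ler0n //.
by apply: sumr_ge0 => p _; apply: sqr_ge0.
Qed.

(** At the value 3/8 every nonnegative term vanishes: x_00 = 1/2, then x_ii = 1 - 1/2 in the block.
    The diagonal is nonzero there, so the off-diagonal zeros come from the measurements. *)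
Lemma al_opt_unique X : al_opt cost measure (measure Xopt) 1 0 X -> Xal = X.
Proof.
move=> [Xpsd /(_ Xal psd_Xal)].
rewrite aug_lagrangian_Xal aug_lagrangian_squares gerDl.
have t0 := tail_trace_ge0 Xpsd.
have s0 := sqr_ge0 ((X : 'M_n.+1) 0 0 - 2^-1).
have m0 : 0 <= offcorner_misfit X by apply: sumr_ge0 => p _; apply: sqr_ge0.
move=> le0.
have tail0 : tail_trace X = 0 by lra.
have X00 : (X : 'M_n.+1) 0 0 = 2^-1.
  by apply/eqP; rewrite -subr_eq0 -sqrf_eq0; apply/eqP; lra.
have mis0 : offcorner_misfit X = 0 by lra.
have entryE (i j : 'I_n.+1) : (i <= j < r)%N -> j != 0 ->
    entry X (i, j) = entry Xopt (i, j).
  move=> ij j0; apply/eqP; rewrite -subr_eq0 -sqrf_eq0; apply/eqP.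
  apply: (psumr_eq0P _ mis0) => [q _|]; first exact: sqr_ge0.
  by rewrite /block ij xpair_eqE (negPf j0) andbF.
apply: (psd_eq_diag_sym Xpsd) => [i|i j ij].
  case: ltnP => ir; last exact: tail_trace_eq0.
  have [->//|i0] := eqVneq i 0.
  have := entryE i i; rewrite leqnn ir => /(_ isT i0).
  rewrite entry_diag /entry /= !eqxx i0 (negPf i0) X00 /=.
  by move=> e; lra.
case: ifP => [ir _|]; last by rewrite eqxx.
case: ifP => [jr _|]; last by rewrite eqxx.
have j0 : j != 0 by rewrite -val_eqE -lt0n (leq_ltn_trans _ ij).
have ij' : (i == j) = false by rewrite -val_eqE ltn_eqF.
have := entryE i j; rewrite (ltnW ij) jr => /(_ isT j0).
by rewrite entry_diag /entry /= ij' addr0.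
Qed.

Lemma rank_Xal : \rank Xal = r.
Proof.
have -> : (Xal : 'M_n.+1) = 2^-1 *: pid_mx r.
  apply/matrixP => i j; rewrite diag_symE !mxE; case: eqP => [->|/eqP ij].
    by rewrite eqxx; case: ifP; rewrite /= ?mulr1 ?mulr0.
  by rewrite val_eqE (negPf ij) mulr0.
by rewrite mxrank_scale_nz ?rank_pid_mx // invr_eq0 pnatr_eq0.
Qed.

Lemma psd_cost : psd cost.
Proof.
by apply: psd_diag_sym => i; case: ifP => _; rewrite ?invr_ge0 ler0n.
Qed.

End Instance.

Theorem mainTheorem4 (R : realType) (m n : nat)
  (hm : (3 <= m)%N) (hn : (2 <= n)%N) (hmn : (m <= (n * (n + 1)) %/ 2)%N) :
  exists (C : 'S[R]_n) (A : {linear 'S[R]_n -> 'cV[R]_m}) (b : 'cV[R]_m),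
    [/\ exists Xstar : 'S[R]_n,
          unique (primal_opt C A b) Xstar /\ \rank Xstar = 1%N,
        strict_complementarity C A b
      & exists y : 'cV[R]_m,
          dual_feasible C A y /\
          exists Xy : 'S[R]_n,
            unique (al_opt C A b 1 y) Xy /\
            is_maxn (fun l : nat => ((l * (l + 1)) %/ 2 <= m)%N) (\rank Xy)].
Proof.
case: n hn hmn => // n _ hmn.
have [r [r_tri rmax]] := triangular_root m.
have r_gt0 : (0 < r)%N by apply: rmax; apply: leq_trans hm.
(* The block fits into the matrix: otherwise the triangular number of n + 2 would be at most m,
   hence at most that of n + 1. *)
have r_le : (r <= n.+1)%N.
  rewrite leqNgt; apply/negP => /leq_triangular.
  rewrite triangular_succ => /leq_trans /(_ r_tri) /leq_trans /(_ hmn).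
  by rewrite leqNgt -[X in (X < _)%N]addn0 ltn_add2l.
exists (@cost R n r), (@measure R m n r), (@measure R m n r (@Xopt R n)); split.
- exists (@Xopt R n); split; last exact: rank_Xopt.
  split; first exact: primal_opt_Xopt.
  by move=> X; apply: primal_opt_unique.
- exact: strict_complementarity_Xopt.
(* At y = 0 the slack is [cost], a nonnegative diagonal matrix. *)
exists 0; split.
  by rewrite /dual_feasible slack0; apply: psd_cost.
exists (@Xal R n r); split; last by rewrite rank_Xal.
split; first exact: al_opt_Xal.
by move=> X; apply: al_opt_unique.
Qed.
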